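(* Let $\mathbb{F}$ be a field of characteristic $0$, let $1\le k<n$ be integers, and let $\Phi:M_n(\mathbb{F})\to M_k(\mathbb{F})$ be a multiplicative map with $\Phi(0)=0$ and $\Phi(I_n)=I_k$. Then $\Phi$ is trivial, i.e. $\Phi(A)=I_k$ for every $A\in\operatorname{SL}(n,\mathbb{F})$.
   Context: $M_m(\mathbb{F})$ is the algebra of $m\times m$ matrices over $\mathbb{F}$ and $I_m$ is the identity matrix. A map $\Phi:M_n(\mathbb{F})\to M_k(\mathbb{F})$ is multiplicative if $\Phi(AB)=\Phi(A)\Phi(B)$ for all $A,B\in M_n(\mathbb{F})$ (no linearity is assumed). *)

(* Defs.v *)
From HB Require Import structures.
From mathcomp Require Import all_boot all_order all_algebra.

Set Implicit Arguments.
Unset Strict Implicit.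
Unset Printing Implicit Defensive.

Import GRing.Theory.
Local Open Scope ring_scope.

Definition mx_multiplicative (F : fieldType) (n k : nat)
    (Phi : 'M[F]_n -> 'M[F]_k) : Prop :=
  forall A B : 'M[F]_n, Phi (A *m B) = Phi A *m Phi B.

(* SL(n, F) as a predicate: MathComp's linear groups are finite groups, hence
   only available over finite rings. *)
Definition SL (F : fieldType) (n : nat) (A : 'M[F]_n) : Prop := \det A = 1.

Definition mx_trivial (F : fieldType) (n k : nat)
    (Phi : 'M[F]_n -> 'M[F]_k) : Prop :=
  forall A : 'M[F]_n, SL A -> Phi A = 1%:M.

(* Main.v *)
(* The reflections d_i = diag(1, .., -1, .., 1) are sent to commuting
   involutions D_i, which are simultaneously diagonalizable. A joint eigenvector
   on which the D_i do not all act by the same sign has at least n distinct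
   translates under the permutation matrices, i.e. n linearly independent
   vectors in F^k, contradicting k < n. Hence all the D_i are equal, say to D.
   If n >= 3, a transvection t_ij(x) commutes with d_l for l <> i, j; if k = 1
   everything commutes; so D commutes with the image of t_ij(x). Since
   d_i t_ij(x) d_i = t_ij(-x), the images of t_ij(x) and t_ij(-x) agree, so that
   of t_ij(2x) is trivial; and transvections generate SL(n, F). *)

Require Import Defs.
From HB Require Import structures.
From mathcomp Require Import all_boot all_order all_algebra.
From mathcomp Require Import fingroup perm ring.

Set Implicit Arguments.
Unset Strict Implicit.
Unset Printing Implicit Defensive.

Import GRing.Theory.
Local Open Scope ring_scope.

Definition transvection (F : fieldType) n (i j : 'I_n) (x : F) : 'M[F]_n :=
  1%:M + x *: delta_mx i j.

Definition reflection (F : fieldType) n (i : 'I_n) : 'M[F]_n :=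
  diag_mx (\row_j (if j == i then -1 else 1)).
Arguments reflection F {n} i.

(** * Generation of the special linear group by transvections *)

Section Transvections.
Variables (F : fieldType).

Lemma mul_transvection n (i j : 'I_n) (x y : F) : i != j ->
  transvection i j x *m transvection i j y = transvection i j (x + y).
Proof.
move=> ij; rewrite /transvection mulmxDl mul1mx mulmxDr mulmx1.
rewrite -scalemxAl -scalemxAr mul_delta_mx_0 1?eq_sym // !scaler0 addr0.
by rewrite -addrA -scalerDl [y + x]addrC.
Qed.

Lemma transvection0 n (i j : 'I_n) : transvection i j (0 : F) = 1%:M.
Proof. by rewrite /transvection scale0r addr0. Qed.

Lemma transvectionKl n (i j : 'I_n) (x : F) (A : 'M[F]_n) : i != j ->
  transvection i j (- x) *m (transvection i j x *m A) = A.
Proof.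
by move=> ij; rewrite mulmxA mul_transvection // addNr transvection0 mul1mx.
Qed.

Lemma det_transvection n (i j : 'I_n) (x : F) : i != j ->
  \det (transvection i j x) = 1.
Proof.
(* Transposing exchanges [i] and [j], so the matrix may be taken lower triangular. *)
wlog ltij : i j / (j < i)%N => [hw ij|_].
  case: (ltngtP j i) => [h|h|h]; first exact: hw.
    rewrite -det_tr /transvection linearD /= trmx1 linearZ /= trmx_delta.
    by apply: hw; rewrite 1?eq_sym.
  by rewrite (val_inj h) eqxx in ij.
rewrite det_trig; last first.
  apply/is_trig_mxP => a b ltab; rewrite !mxE -!val_eqE /= ltn_eqF // add0r.
  have [ai|_] := eqVneq (a : nat) i; last by rewrite mulr0.
  have [bj|_] := eqVneq (b : nat) j; last by rewrite mulr0.
  by move: ltab; rewrite ai bj ltnNge ltnW.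
apply: big1 => a _; rewrite !mxE eqxx.
case: (a =P i) => [->|]; rewrite /= ?mulr0 ?addr0 //.
by rewrite -val_eqE /= gtn_eqF // mulr0 addr0.
Qed.

Lemma mul_transvection_entry n (i j : 'I_n) (x : F) (A : 'M[F]_n) l :
  (transvection i j x *m A) i l = A i l + x * A j l.
Proof.
rewrite /transvection mulmxDl mul1mx -scalemxAl !mxE; congr (_ + _ * _).
rewrite (bigD1 j) //= !mxE !eqxx mul1r big1 ?addr0 // => a /negPf aj.
by rewrite !mxE aj andbF mul0r.
Qed.

Lemma block_transvection n (i j : 'I_n) (x : F) :
  block_mx (1%:M : 'M_1) 0 0 (transvection i j x)
  = transvection (rshift 1 i) (rshift 1 j) x.
Proof.
apply/matrixP => a b; rewrite !mxE.
case: (splitP a) => a' ea; rewrite !mxE; case: (splitP b) => b' eb;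
  rewrite !mxE -!val_eqE /= !ea !eb ?eqn_add2l ?ord1 //=;
  by rewrite ?add1n /= ?andbF ?mulr0 ?addr0 ?add0r.
Qed.

Lemma block_ldelta n (i : 'I_n) (x : F) :
  block_mx (1%:M : 'M_1) 0 (x *: delta_mx i 0) 1%:M
  = transvection (rshift 1 i) (lshift n 0) x.
Proof.
apply/matrixP => a b; rewrite !mxE.
case: (splitP a) => a' ea; rewrite !mxE; case: (splitP b) => b' eb;
  rewrite !mxE -!val_eqE /= !ea !eb ?eqn_add2l ?ord1 //=;
  by rewrite ?add1n /= ?andbF ?mulr0 ?addr0 ?add0r.
Qed.

Lemma block_rdelta n (i : 'I_n) (x : F) :
  block_mx (1%:M : 'M_1) (x *: delta_mx 0 i) 0 1%:M
  = transvection (lshift n 0) (rshift 1 i) x.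
Proof.
apply/matrixP => a b; rewrite !mxE.
case: (splitP a) => a' ea; rewrite !mxE; case: (splitP b) => b' eb;
  rewrite !mxE -!val_eqE /= !ea !eb ?eqn_add2l ?ord1 //=;
  by rewrite ?add1n /= ?andbF ?mulr0 ?addr0 ?add0r.
Qed.

(** Gaussian elimination: row operations bring the corner entry to 1, and splitting off its row and
    column leaves a smaller matrix of determinant 1, handled by induction. *)
Lemma SL_transvection_ind n (K : 'M[F]_n -> Prop) :
  K 1%:M -> (forall A B, K A -> K B -> K (A *m B)) ->
  (forall i j x, i != j -> K (transvection i j x)) ->
  forall A, SL A -> K A.
Proof.
elim: n K => [|m IHm] K K1 KM Kt A.
  by rewrite (_ : A = 1%:M) // [LHS]flatmx0 [RHS]flatmx0.
rewrite /SL; case: m IHm K K1 KM Kt A => [|m] IHm K K1 KM Kt A detA.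
  suff -> : A = 1%:M by [].
  by rewrite [A]mx11_scalar -det_mx11 detA.
have KMb (B C : 'M[F]_(1 + m.+1)) : K B -> K C -> K (B *m C) := KM B C.
have Kcancel i j x B : i != j -> K (transvection i j x *m B) -> K B.
  by move=> ij KB; rewrite -(transvectionKl x B ij); apply: KM (Kt _ _ _ ij) KB.
have pivot1 (B : 'M[F]_(1 + m.+1)) : \det B = 1 -> B 0 0 = 1 -> K B.
  move=> detB B00; have ulB : ulsubmx B = 1%:M.
    apply/matrixP => a b; rewrite !mxE !ord1 eqxx -B00.
    by congr (B _ _); apply/val_inj.
  rewrite -[B]submxK ulB.
  set r := ursubmx B; set c := dlsubmx B; set M := drsubmx B.
  (* Block LDU factorization with Schur complement [M - c *m r]; the outer factors multiply by
     adding their [c] or [r], hence split into transvections. *)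
  have Bdec : block_mx 1%:M r c M = block_mx (1%:M : 'M_1) 0 c 1%:M *m
      (block_mx 1%:M 0 0 (M - c *m r) *m block_mx 1%:M r 0 1%:M).
    rewrite !mulmx_block !(mul1mx, mulmx1, mul0mx, mulmx0, addr0, add0r).
    by rewrite addrC subrK.
  rewrite Bdec; apply: (KM _ _); last apply: (KM _ _).
  - rewrite [c]matrix_sum_delta.
    apply: (big_ind (fun c : 'cV_m.+1 => K (block_mx (1%:M : 'M_1) 0 c 1%:M))).
    + by rewrite -scalar_mx_block.
    + move=> c1 c2 Kc1 Kc2; have := KMb _ _ Kc1 Kc2; rewrite mulmx_block.
      by rewrite !(mul1mx, mulmx1, mul0mx, mulmx0, addr0, add0r).
    + move=> i _; rewrite big_ord1 block_ldelta; exact: Kt.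
  - apply: (IHm (fun M => K (block_mx (1%:M : 'M_1) 0 0 M))).
    + by rewrite -scalar_mx_block.
    + move=> M1 M2 KM1 KM2; have := KMb _ _ KM1 KM2; rewrite mulmx_block.
      by rewrite !(mul1mx, mulmx1, mul0mx, mulmx0, addr0, add0r).
    + move=> i j x ij; rewrite block_transvection; apply: Kt.
      by rewrite -val_eqE /= eqn_add2l.
    + move: detB; rewrite -[B]submxK ulB Bdec !det_mulmx.
      rewrite !(det_lblock (1%:M : 'M_1)) (det_ublock (1%:M : 'M_1)) !det1.
      by rewrite !mul1r mulr1.
  - rewrite [r]matrix_sum_delta big_ord1.
    apply: (big_ind (fun r : 'rV_m.+1 => K (block_mx (1%:M : 'M_1) r 0 1%:M))).
    + by rewrite -scalar_mx_block.
    + move=> r1 r2 Kr1 Kr2; have := KMb _ _ Kr2 Kr1; rewrite mulmx_block.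
      by rewrite !(mul1mx, mulmx1, mul0mx, mulmx0, addr0, add0r).
    + move=> i _; rewrite block_rdelta; exact: Kt.
have entry (B : 'M[F]_m.+2) i : \det B = 1 -> i != 0 -> B i 0 != 0 -> K B.
  move=> detB i0 Bi0; have i0' : 0 != i by rewrite eq_sym.
  (* This multiple of row [i], added to row 0, turns the corner entry into 1. *)
  apply: (Kcancel 0 i ((1 - B 0 0) / B i 0)) => //; apply: pivot1.
    by rewrite det_mulmx det_transvection // detB mulr1.
  by rewrite mul_transvection_entry divfK // addrC subrK.
have [A10|A10] := eqVneq (A (lift 0 0) 0) 0; last exact: entry A10.
have [i Ai|colA0] := pickP (fun i => (i != 0) && (A i 0 != 0)).
  by case/andP: Ai; apply: entry.
(* Column 0 vanishes below the corner, so the corner is nonzero by [detA]; adding row 0 to row 1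
   reduces to [entry]. *)
apply: (Kcancel (lift 0 0) 0 1) => //.
apply: (entry _ (lift 0 0)) => //.
  by rewrite det_mulmx det_transvection // detA mulr1.
rewrite mul_transvection_entry A10 add0r mul1r; apply/eqP => A00.
move: detA; rewrite (expand_det_col _ 0) big1 => [|i _].
  by move/eqP; rewrite eq_sym oner_eq0.
have [->|i0] := eqVneq i 0; first by rewrite A00 mul0r.
by have := colA0 i; rewrite i0 => /negbFE/eqP->; rewrite mul0r.
Qed.

End Transvections.

(** * Joint eigenvectors of commuting involutions and orbits of sign patterns *)

Section CommutingInvolutions.
Variables (F : fieldType) (two_neq0 : (2%:R : F) != 0) (n k : nat).

(** The vector [v] is [w] times a product of factors [1 + D i], so eigenvalue relations of [w] under
    matrices commuting with every [D i] pass to [v]. *)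
Lemma joint_eigenvector (D : 'I_n -> 'M[F]_k) (w : 'rV[F]_k) :
  (forall i, D i *m D i = 1%:M) -> (forall i j, D i *m D j = D j *m D i) ->
  w != 0 ->
  exists (v : 'rV[F]_k) (e : 'I_n -> bool),
    [/\ v != 0, forall i, v *m D i = (-1) ^+ e i *: v &
      forall N c, (forall i, N *m D i = D i *m N) ->
        w *m N = c *: w -> v *m N = c *: v].
Proof.
move=> DD DC w0.
suff [v [v0 vD vN]] : exists v : 'rV[F]_k,
    [/\ v != 0, forall i, i \in enum 'I_n -> v *m D i = v \/ v *m D i = - v &
      forall N c, (forall i, N *m D i = D i *m N) ->
        w *m N = c *: w -> v *m N = c *: v].
  exists v, (fun i => v *m D i != v); split=> // i.
  have [->|vDi] := eqVneq; first by rewrite scale1r.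
  by rewrite scaleN1r; case: (vD i) vDi => [|->|//]; rewrite ?mem_enum ?eqxx.
elim: (enum 'I_n) => [|i r [v [v0 vD vN]]]; first by exists w; split.
(* If [1 + D i] kills [v], then [D i] negates [v]; otherwise the image of [v] is fixed by [D i],
   since [D i] squares to 1. *)
have [vi|vi] := eqVneq (v *m (1%:M + D i)) 0.
  exists v; split=> // j; rewrite in_cons => /predU1P[->|/vD //]; right.
  by apply/eqP; rewrite -addr_eq0 addrC -[v in v + _]mulmx1 -mulmxDr vi.
exists (v *m (1%:M + D i)); split=> // [j|N c NC wN]; last first.
  have -> : v *m (1%:M + D i) *m N = v *m N *m (1%:M + D i).
    rewrite -!mulmxA; congr (_ *m _).
    by rewrite mulmxDl mulmxDr mul1mx mulmx1 NC.
  by rewrite (vN N c) // -scalemxAl.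
rewrite in_cons => /predU1P[->|/vD vDj].
  by left; rewrite -mulmxA mulmxDl mul1mx DD addrC.
have -> : v *m (1%:M + D i) *m D j = v *m D j *m (1%:M + D i).
  by rewrite -!mulmxA; congr (_ *m _); rewrite mulmxDl mulmxDr mul1mx mulmx1 DC.
by case: vDj => ->; [left | right; rewrite mulNmx].
Qed.

(** Joint eigenvectors with pairwise distinct sign patterns are linearly independent. *)
Lemma distinct_characters_free m (D : 'I_n -> 'M[F]_k) (V : 'M[F]_(m, k))
    (e : 'I_m -> 'I_n -> bool) :
  (forall c, row c V != 0) ->
  (forall c i, row c V *m D i = (-1) ^+ e c i *: row c V) ->
  (forall c d, e c =1 e d -> c = d) -> (m <= k)%N.
Proof.
move=> V0 VD e_inj; apply: leq_trans (rank_leq_col V); rewrite row_leq_rank.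
(* Over all [i], the product of the [D i + (-1) ^+ e c i] scales row [c] by factors 2 or -2 and
   kills every other row, whose signs differ from those of [c] somewhere. *)
have isolate c (r : seq 'I_n) : exists M, forall d, row d V *m M =
    (\prod_(i <- r) ((-1) ^+ e d i + (-1) ^+ e c i)) *: row d V.
  elim: r => [|i r [M VM]].
    by exists 1%:M => d; rewrite big_nil scale1r mulmx1.
  exists (M *m (D i + ((-1) ^+ e c i)%:M)) => d.
  rewrite mulmxA VM -scalemxAl mulmxDr VD mul_mx_scalar -scalerDl scalerA.
  by rewrite big_cons mulrC.
apply/inj_row_free => w wV; apply/rowP => c; rewrite mxE.
have [M VM] := isolate c (enum 'I_n).
move: wV; rewrite mulmx_sum_row => /(congr1 (mulmx^~ M)) /=.
rewrite mul0mx mulmx_suml (bigD1 c) //= big1 => [|d dc].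
  rewrite addr0 -scalemxAl VM scalerA => /eqP.
  rewrite scaler_eq0 (negPf (V0 c)) orbF mulf_eq0 => /orP[/eqP //|].
  rewrite prodf_seq_eq0 => /hasP[i _] /=.
  by rewrite -mulr2n -mulr_natr mulf_eq0 signr_eq0 (negPf two_neq0).
have [i edi] : exists i, e d i != e c i.
  apply/existsP; apply: contraR dc; rewrite negb_exists => /forallP edc.
  by apply/eqP/e_inj => i; apply/eqP; rewrite -[_ == _]negbK edc.
rewrite -scalemxAl VM (bigD1_seq i) ?mem_enum ?enum_uniq //=.
suff -> : (-1) ^+ e d i + (-1) ^+ e c i = 0 :> F.
  by rewrite mul0r scale0r scaler0.
move: edi; case: (e d i) (e c i) => [] [] //= _;
  by rewrite expr0 expr1 (addNr, subrr).
Qed.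

(* The witnesses are [S] itself together with the sets obtained from it by
   exchanging [a] for a point outside, or a point of [S] other than [a] for [b],
   where [S] is the support of [e]. *)
Lemma nonconstant_orbit (e : 'I_n -> bool) a b : e a -> ~~ e b ->
  exists s : 'I_n -> {perm 'I_n},
    forall c d, (forall j, e (s c j) = e (s d j)) -> c = d.
Proof.
move=> ea neb; have ab : a != b by apply: contraNneq neb => <-.
exists (fun c => if ~~ e c then tperm a c else
              if c == a then 1%g else tperm c b).
have neq x y : e x -> ~~ e y -> y != x by move=> ex; apply: contraNneq => ->.
(* The first kind of exchange removes [a] from the support, the second keeps it. *)
have mixed c d : ~~ e c -> e d ->
    ~ (forall j, e (tperm a c j) =
         e ((if d == a then 1%g else tperm d b) j)).
  move=> nec ed /(_ a); rewrite tpermL (negPf nec).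
  have [_|da] := eqVneq d a; first by rewrite perm1 ea.
  by rewrite tpermD ?ea // eq_sym.
move=> c d; case: (boolP (e c)) => ec; case: (boolP (e d)) => ed /= H.
- have single x : e x -> x != a ->
    ~ (forall j, e (tperm x b j) = e j).
    by move=> ex _ /(_ x); rewrite tpermL ex (negPf neb).
  move: H; have [->|ca] := eqVneq c a; have [->|da] := eqVneq d a => // H.
  + by case: (single d ed da) => j; rewrite -H perm1.
  + by case: (single c ec ca) => j; rewrite H perm1.
  + apply/eqP; apply: contraT => cd; move: (H c).
    by rewrite tpermL tpermD ?ec ?(negPf neb) 1?eq_sym // eq_sym neq.
- by case: (mixed d c).
- by case: (mixed c d).
- apply/eqP; apply: contraT => cd; move: (H c).
  by rewrite tpermR ea tpermD ?(negPf ec) // eq_sym // neq.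
Qed.

End CommutingInvolutions.

(** * Relations of reflections with permutation matrices and transvections *)

Section Reflections.
Variables (F : fieldType) (n : nat).
Implicit Types (i j : 'I_n).

Lemma reflectionK i : reflection F i *m reflection F i = 1%:M.
Proof.
rewrite mulmx_diag -diag_const_mx; congr diag_mx; apply/rowP => a.
by rewrite !mxE; case: eqP; rewrite ?mulrNN mulr1.
Qed.

Lemma reflectionC i j :
  reflection F i *m reflection F j = reflection F j *m reflection F i.
Proof. exact: diag_mxC. Qed.

Lemma perm_mx_reflection (s : {perm 'I_n}) i :
  perm_mx s *m reflection F (s i) = reflection F i *m perm_mx s.
Proof.
rewrite mul_mx_diag mul_diag_mx.
apply/matrixP => a b; rewrite !mxE.
have [<-|] := eqVneq (s a) b; last by rewrite mul0r mulr0.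
by rewrite (inj_eq perm_inj) mul1r mulr1.
Qed.

Lemma reflection_transvection i j x : i != j ->
  reflection F i *m transvection i j x =
    transvection i j (- x) *m reflection F i.
Proof.
move=> ij; rewrite mul_mx_diag mul_diag_mx.
apply/matrixP => a b; rewrite !mxE.
have [->|ai] := eqVneq a i; have [->|bi] := eqVneq b i;
  rewrite ?eqxx ?(negPf ij) /=; try ring.
by rewrite (negPf ai) /=; ring.
Qed.

Lemma reflection_transvectionC i j l x : l != i -> l != j ->
  reflection F l *m transvection i j x = transvection i j x *m reflection F l.
Proof.
move=> li lj; rewrite mul_mx_diag mul_diag_mx.
apply/matrixP => a b; rewrite !mxE.
have [->|al] := eqVneq a l; have [->|bl] := eqVneq b l;
  rewrite ?eqxx ?(negPf li) ?(negPf lj) /= ?andbF; try ring.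
by rewrite (negPf al) /=; ring.
Qed.

End Reflections.

(** * Images of reflections and transvections *)

Section Characters.
Variables (F : fieldType) (two_neq0 : (2%:R : F) != 0) (n k : nat).
Variables (Phi : 'M[F]_n -> 'M[F]_k).
Hypotheses (PhiM : mx_multiplicative Phi) (Phi1 : Phi 1%:M = 1%:M).

Lemma image_reflection_eq a b : (k < n)%N ->
  Phi (reflection F a) = Phi (reflection F b).
Proof.
move=> lt_kn; apply/eqP; apply: contraTT lt_kn => Dab; rewrite -leqNgt.
pose D i := Phi (reflection F i).
have DD i : D i *m D i = 1%:M by rewrite /D -PhiM reflectionK.
have DC i j : D i *m D j = D j *m D i by rewrite /D -!PhiM reflectionC.
(* Rows of [1 - D a *m D b] are negated by [D a *m D b]; starting from a nonzero one forces opposite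
   signs at [a] and [b]. *)
have [i wi] : exists i, row i (1%:M - D a *m D b) != 0.
  apply/existsP; apply: contraR Dab; rewrite negb_exists => /forallP w0.
  have : 1%:M - D a *m D b = 0.
    by apply/row_matrixP => i; rewrite row0; apply/eqP;
      rewrite -[_ == _]negbK w0.
  move/eqP; rewrite subr_eq0 => /eqP/(congr1 (mulmx (D a))).
  by rewrite mulmx1 mulmxA DD mul1mx /D => ->.
have [v [e [v0 vD vN]]] := joint_eigenvector DD DC wi.
have vab : v *m (D a *m D b) = (-1) *: v.
  apply: vN => [j|]; first by rewrite -mulmxA DC mulmxA DC -mulmxA.
  rewrite -row_mul mulmxBl mul1mx.
  rewrite -{2}(DC b a) mulmxA -[X in _ - X *m _]mulmxA DD mulmx1 DD.
  by rewrite scaleN1r -opprB linearN.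
have eab : e a != e b.
  apply: contraNneq v0 => eab; move: vab.
  rewrite mulmxA vD -scalemxAl vD scalerA eab -expr2 sqrr_sign scale1r scaleN1r.
  move/eqP; rewrite -addr_eq0 -mulr2n -scaler_nat scaler_eq0.
  by rewrite (negPf two_neq0).
have [s s_inj] : exists s : 'I_n -> {perm 'I_n},
    forall c d, (forall j, e (s c j) = e (s d j)) -> c = d.
  case ea: (e a); case eb: (e b); rewrite ea eb // in eab.
    by apply: (nonconstant_orbit (a := a) (b := b)); rewrite ?ea ?eb.
  by apply: (nonconstant_orbit (a := b) (b := a)); rewrite ?ea ?eb.
(* With the inverse permutation, [D j] acts on row [c] by the sign of index [s c j]. *)
pose V := \matrix_c (v *m Phi (perm_mx (s c)^-1%g)).
apply: (distinct_characters_free two_neq0 (D := D) (V := V)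
          (e := fun c j => e (s c j))) => [c|c j|c d]; last exact: s_inj.
  rewrite rowK; apply: contraNneq v0.
  move=> /(congr1 (mulmx^~ (Phi (perm_mx (s c))))).
  by rewrite -mulmxA -PhiM -perm_mxM mulVg perm_mx1 Phi1 mulmx1 mul0mx => ->.
rewrite rowK -mulmxA -PhiM -{1}[j](permK (s c)) perm_mx_reflection.
by rewrite PhiM mulmxA vD scalemxAl.
Qed.

Lemma image_transvection i j x : (0 < k < n)%N -> i != j ->
  Phi (transvection i j x) = 1%:M.
Proof.
case/andP=> k_gt0 lt_kn ij.
have DtC y : Phi (reflection F i) *m Phi (transvection i j y) =
    Phi (transvection i j y) *m Phi (reflection F i).
  (* For [k = 1] all images commute, which covers [n = 2]; otherwise [n] is at least 3 and a third
     index [l] exists. *)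
  have [k1|k_neq1] := eqVneq k 1%N.
    by case: _ / (esym k1) (Phi _) (Phi _) => A B;
      rewrite [A]mx11_scalar scalar_mxC.
  have [l /andP[li lj]] : exists l, (l != i) && (l != j).
    apply/existsP; apply: contraLR lt_kn.
    rewrite negb_exists => /forallP all_ij.
    rewrite -leqNgt -[n]card_ord; apply: (@leq_trans #|[set i; j]|).
      by apply/subset_leq_card/subsetP => l _; move: (all_ij l);
        rewrite !inE -negb_or negbK.
    by rewrite cards2 ij; case: (k) k_gt0 k_neq1 => [|[]].
  rewrite (image_reflection_eq i l lt_kn) -!PhiM.
  by rewrite reflection_transvectionC.
(* Conjugation by the reflection negates [y], yet its image commutes with that of the
   transvection. *)
have tN y : Phi (transvection i j y) = Phi (transvection i j (- y)).
  rewrite -[LHS]mul1mx -Phi1 -(reflectionK F i) PhiM -mulmxA DtC mulmxA.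
  rewrite -PhiM reflection_transvection // PhiM -mulmxA -PhiM.
  by rewrite reflectionK Phi1 mulmx1.
(* Halving [x] writes the image as a square, and [tN] makes its two factors mutually inverse. *)
have -> : x = x / 2%:R + x / 2%:R
  by rewrite -mulrDl -mulr2n -[x *+ 2]mulr_natr mulfK.
rewrite -mul_transvection // PhiM {1}tN -PhiM mul_transvection //.
by rewrite addNr transvection0.
Qed.

End Characters.

Theorem proposition2p4 (F : fieldType) (charF0 : [pchar F] =i pred0)
    (n k : nat) (k_ge1 : (1 <= k)%N) (lt_kn : (k < n)%N)
    (Phi : 'M[F]_n -> 'M[F]_k)
    (PhiM : mx_multiplicative Phi)
    (Phi0 : Phi 0 = 0)
    (Phi1 : Phi 1%:M = 1%:M) :
  mx_trivial Phi.
Proof.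
have two_neq0 : (2%:R : F) != 0 by rewrite ((pcharf0P F).1 charF0).
apply: SL_transvection_ind => // [A B PhiA PhiB|i j x ij].
  by rewrite PhiM PhiA PhiB mulmx1.
by apply: image_transvection; rewrite ?k_ge1.
Qed.
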